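(* Let $\mathbb{F}$ be a field of characteristic not $2$. Let $p\in\mathbb{F}[t]$ be a monic palindromial of degree $2$ with no root in $\{1,-1\}$. Let $s$ be a symplectic form on a finite-dimensional vector space $V$ over $\mathbb{F}$ and let $u\in\mathrm{Sp}(s)$ have minimal polynomial $(t-1)\,p(t)$ and be such that $\operatorname{Ker} p(u)$ has dimension $2$. Then $u$ is not $3$-reflectional in $\mathrm{Sp}(s)$.
   Context: A symplectic form is a nondegenerate alternating bilinear form; $\mathrm{Sp}(s)$ is its isometry group in $\mathrm{GL}(V)$. For a polynomial $p$ of degree $d>0$ with $p(0)\neq 0$, the reciprocal polynomial is $p^\sharp:=p(0)^{-1}t^d p(t^{-1})$, and $p$ is a palindromial if $p=p^\sharp$. An involution of a group is an element $i$ with $i^2$ equal to the identity (the identity is allowed). An element of a group is $k$-reflectional if it is the product of $k$ involutions of that group. *)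

(* Defs.v *)
From mathcomp Require Import all_boot all_order all_algebra.

Set Implicit Arguments.
Unset Strict Implicit.
Unset Printing Implicit Defensive.

Import GRing.Theory.
Local Open Scope ring_scope.

Section Palindromials.
Variable F : fieldType.
Implicit Type p : {poly F}.

(* p(0)^{-1} t^d p(t^{-1}) with d the degree of p, i.e. d = (size p).-1; the
   exponents d - i, i < size p, are never truncated. *)
Definition reciprocal_poly p : {poly F} :=
  p.[0]^-1 *: \sum_(i < size p) p`_i *: 'X^((size p).-1 - i).

Definition palindromial p : Prop :=
  [/\ (1 < size p)%N, p.[0] != 0 & p = reciprocal_poly p].

End Palindromials.

Section Endomorphisms.
Variables (F : fieldType) (V : vectType F).
Implicit Types (u : 'End(V)) (p q : {poly F}).

(* The algebra structure on 'End(V) in vector.v is not canonical (it requires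
   V to be nonzero), so polynomials are evaluated at u explicitly. *)
Definition lfun_horner p u : 'End(V) :=
  \sum_(i < size p) p`_i *: iter i (comp_lfun u) \1%VF.

(* The minimal polynomial of u is the monic generator of the ideal of the
   polynomials annihilating u. *)
Definition is_minpoly u q : Prop :=
  q \is monic /\ forall p, lfun_horner p u = 0 <-> q %| p.

End Endomorphisms.

Section SymplecticGroup.
Variables (F : fieldType) (V : vectType F) (s : {biscalar V}).
Implicit Types (f u : 'End(V)) (x y : V).

Definition symplectic_form : Prop :=
  (forall x, s x x = 0) /\ (forall x, (forall y, s x y = 0) -> x = 0).

(* In finite dimension, f is in GL(V) iff its kernel is trivial. *)
Definition Sp f : Prop :=
  lker f = 0%VS /\ forall x y, s (f x) (f y) = s x y.

Definition Sp_involution f : Prop := Sp f /\ (f \o f)%VF = \1%VF.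

Definition Sp_reflectional (k : nat) u : Prop :=
  exists i : 'I_k -> 'End(V),
    (forall j, Sp_involution (i j)) /\
    u = \big[@comp_lfun F V V V / \1%VF]_(j < k) i j.

End SymplecticGroup.

Lemma symplectic_formE (F : fieldType) (V : vectType F)
    (s : {skew_symmetric V}) : symplectic_form s <-> is_psymplectic s.
Proof.
split=> [[alt ndg]|[/eqP ndg _ alt2]].
  split=> //; rewrite /nondegenerate -subv0; apply/subvP => x.
  move/mem_orthovP => sx0; rewrite memv0; apply/eqP/ndg => y.
  by apply: sx0; rewrite memvf.
split=> [x|x sx0].
  have [/alt2 alt|n2] := boolP (2 \in [pchar F]); first exact: alt.
  have := hermC s x x; rewrite /= mulN1r => /eqP.
  rewrite -addr_eq0 -mulr2n -mulr_natr mulf_eq0 => /orP[/eqP //|].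
  by move: n2; rewrite inE /= => /negPf ->.
apply/eqP; rewrite -memv0 -ndg; apply/mem_orthovP => y _; exact: sx0.
Qed.

(* Main.v *)
Require Import Defs.
From mathcomp Require Import all_boot all_order all_algebra.
From mathcomp Require Import ring.

(* Write p = t^2 - T t + 1 and suppose that u = abc with involutions a, b, c,
   which are selfadjoint for s. The plane P = Ker p(u) is nondegenerate, u fixes
   its orthogonal, and s(cx, y) = m s(x, y) on P for some scalar m. The operator
   w = ab + ba commutes with a and b; on Q = P + cP it is annihilated by
   X^2 + (2 - T) m X + (2 - T) m^2 - (2 + T), and w^2 - 4 = (ab - ba)^2 maps V
   into Q. Hence some nonzero idempotent in F[w], divisible by w^2 - 4, has its
   image E inside Q. Since ab - ba is injective on E and swaps the eigenspaces
   of a there, which are nondegenerate, dim E >= 4; so E = Q has dimension 4 and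
   w is a scalar on Q, which forces u = -1 on P, against p(-1) <> 0. *)

Import GRing.Theory.
Local Open Scope ring_scope.

(** * Alternating forms and selfadjoint operators *)

Section AlternatingForm.
Variables (F : fieldType) (V : vectType F) (s : {biscalar V}).
Hypothesis s_alt : forall x, s x x = 0.
Hypothesis s_ndg : forall x, (forall y, s x y = 0) -> x = 0.
Hypothesis two_neq0 : 2%:R != 0 :> F.
Implicit Types (f : 'End(V)) (x y z : V).

Definition selfadjoint f := forall x y, s (f x) y = s x (f y).

Lemma form_anti x y : s x y = - s y x.
Proof.
have := s_alt (x + y); rewrite linearD /= !linearDl /= !s_alt => E.
by rewrite -[LHS](subr0) -E; ring.
Qed.

Lemma form_inj x y : (forall z, s x z = s y z) -> x = y.
Proof.
move=> E; apply/eqP; rewrite -subr_eq0; apply/eqP/s_ndg => z.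
by rewrite linearBl /= E subrr.
Qed.

Let lfunD f x y : f (x + y) = f x + f y. Proof. exact: linearD. Qed.
Let lfunN f x : f (- x) = - f x. Proof. exact: linearN. Qed.
Let lfunZ f k x : f (k *: x) = k *: f x. Proof. exact: linearZ. Qed.
Let formD x y z : s (x + y) z = s x z + s y z. Proof. exact: linearDl. Qed.
Let formN x z : s (- x) z = - s x z. Proof. exact: linearNl. Qed.
Let formZ k x z : s (k *: x) z = k * s x z. Proof. exact: linearZl_LR. Qed.
Let form0 z : s 0 z = 0. Proof. exact: linear0l. Qed.
Let formDr x y z : s z (x + y) = s z x + s z y. Proof. exact: linearD. Qed.
Let formNr x z : s z (- x) = - s z x. Proof. exact: linearN. Qed.
Let formZr k x z : s z (k *: x) = k * s z x. Proof. exact: linearZ. Qed.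
Let lfun_lin := (lfunD, lfunN, lfunZ).
Let form_lin := (formD, formN, formZ, form0, formDr, formNr, formZr).

(* Pairing with an arbitrary vector turns an identity between linear
   combinations into one that [ring] can decide. *)
Ltac vector_ring := apply: form_inj => ?; rewrite ?lfun_lin ?form_lin; ring.

(** The witness is sought in a basis: a finite search decides between a nonzero pairing and
    vanishing against every vector. *)
Lemma form_neq0 x : x != 0 -> exists z, s x z != 0.
Proof.
move=> x0; have [/hasP[z _ sz]|/hasPn sx] :=
  boolP (has (fun z => s x z != 0) (vbasis fullv)); first by exists z.
case/eqP: x0; apply: s_ndg => y.
rewrite (coord_vbasis (memvf y)) linear_sum big1 // => i _.
rewrite linearZ /=; have := sx _ (mem_nth 0 (_ : (i < _)%N)).
rewrite size_tuple ltn_ord => /(_ isT); rewrite negbK => /eqP ->.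
by rewrite mulr0.
Qed.

Lemma selfadjoint_alt f x : selfadjoint f -> s (f x) x = 0.
Proof.
move=> sf; have := form_anti (f x) x; rewrite -sf => /eqP.
by rewrite -addr_eq0 -mulr2n -mulr_natl mulf_eq0 (negPf two_neq0) => /eqP.
Qed.

(** * Pairs of selfadjoint involutions *)

Section Dihedral.
Variables (a b e : 'End(V)) (Q : {vspace V}).
Hypotheses (aa : forall x, a (a x) = x) (bb : forall x, b (b x) = x).
Hypotheses (a_sa : selfadjoint a) (b_sa : selfadjoint b) (e_sa : selfadjoint e).
Hypotheses (ee : forall x, e (e x) = e x) (eQ : forall x, e x \in Q).
Hypothesis ea : forall x, e (a x) = a (e x).
Hypothesis eb : forall x, e (b x) = b (e x).
Hypothesis e_comm : forall x, e x = x -> a (b x) = b (a x) -> x = 0.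

(* [a * b - b * a] anticommutes with [a], hence swaps the two eigenspaces of
   [a] in the image of [e]; both are nondegenerate, so each has dimension at
   least 2, and a selfadjoint operator is scalar on a symplectic plane. *)
Lemma dihedral_scalar :
    (\dim Q <= 4)%N -> (exists x, e x != 0) ->
  \dim Q = 4%N /\ exists l, forall x, x \in Q -> a (b x) + b (a x) = l *: x.
Proof.
move=> dQ [x0 ex0].
pose d := ((a \o b) - (b \o a))%VF; pose w := ((a \o b) + (b \o a))%VF.
have dE x : d x = a (b x) - b (a x) by rewrite /d !lfun_simp.
have wE x : w x = a (b x) + b (a x) by rewrite /w !lfun_simp.
have ad x : a (d x) = - d (a x) by rewrite !dE linearB /= !aa opprB.
have ed x : e (d x) = d (e x) by rewrite !dE linearB /= !(ea, eb).
have ew x : e (w x) = w (e x) by rewrite !wE linearD /= !(ea, eb).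
have aw x : a (w x) = w (a x) by rewrite !wE linearD /= !aa addrC.
have dw x : d (w x) = w (d x).
  by rewrite !(wE, dE) !(linearD, linearN) /= !(aa, bb); vector_ring.
have e0 z : e z = z -> d z = 0 -> z = 0.
  by move=> ez /eqP; rewrite dE subr_eq0 => /eqP; exact: e_comm.
(* If the symmetrization of [e x0] vanishes, then [a] negates [e x0], and [d] carries it injectively
   to a vector fixed by [a]. *)
have [x [ex ax x_neq0]] : exists x, [/\ e x = x, a x = x & x != 0].
  have [E|x1] := eqVneq (e x0 + a (e x0)) 0; last first.
    exists (e x0 + a (e x0)); split=> //; last by rewrite linearD /= aa addrC.
    by rewrite linearD /= ea !ee.
  exists (d (e x0)); split; first by rewrite ed ee.
    by move/eqP: E; rewrite addrC addr_eq0 ad => /eqP ->; rewrite linearN opprK.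
  by apply: contraNneq ex0 => /e0 ->; rewrite ?ee.
have [y [ey ay sxy]] : exists y, [/\ e y = y, a y = y & s x y != 0].
  have [z sxz] := form_neq0 _ x_neq0.
  exists (e (2%:R^-1 *: (z + a z))); split; first by rewrite ee.
    by rewrite -ea linearZ linearD /= aa addrC.
  rewrite -e_sa ex linearZ linearD /= -a_sa ax -mulr2n.
  by rewrite -(mulr_natl (s x z)) mulKf.
have syx : s y x = - s x y by exact: form_anti.
pose L k1 k2 k3 k4 := (k1 *: x + k2 *: y) + (k3 *: d x + k4 *: d y).
have aL k1 k2 k3 k4 : a (L k1 k2 k3 k4) = L k1 k2 (- k3) (- k4).
  by rewrite /L !(linearD, linearZ) /= !ad ax ay !scalerN !scaleNr.
have xy0 k1 k2 : k1 *: x + k2 *: y = 0 -> k1 = 0 /\ k2 = 0.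
  move=> E; split; apply/eqP.
    have := congr1 (fun z => s z y) E; rewrite linearDl !linearZl_LR linear0l.
    by rewrite /= s_alt mulr0 addr0 => /eqP; rewrite mulf_eq0 (negPf sxy) orbF.
  have := congr1 (s x) E; rewrite linearD !linearZ linear0.
  by rewrite /= s_alt mulr0 add0r => /eqP; rewrite mulf_eq0 (negPf sxy) orbF.
(* [a] fixes [x], [y] and negates [d x], [d y], so adding the image under [a] isolates the first
   half; injectivity of [d] on the image of [e] handles the second. *)
have L0 k1 k2 k3 k4 : L k1 k2 k3 k4 = 0 -> [/\ k1 = 0, k2 = 0, k3 = 0 & k4 = 0].
  move=> E; have E1 : k1 *: x + k2 *: y = 0.
    have := congr1 a E; rewrite aL linear0 => E'.
    have : L k1 k2 k3 k4 + L k1 k2 (- k3) (- k4) = 0 by rewrite E E' addr0.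
    rewrite /L !scaleNr -opprD addrACA subrr addr0 -mulr2n -scaler_nat.
    by move/eqP; rewrite scaler_eq0 (negPf two_neq0) => /eqP.
  have [-> ->] := xy0 _ _ E1; move: E.
  rewrite /L E1 add0r -!linearZ -linearD /= => /e0.
  rewrite linearD !linearZ /= ex ey => /(_ erefl) /xy0[-> ->].
  by split.
pose X := [:: x; y; d x; d y].
have XE z : z \in <<X>>%VS -> exists k1 k2 k3 k4, z = L k1 k2 k3 k4.
  rewrite -[X]/(tval [tuple x; y; d x; d y]) => /coord_span ->.
  rewrite !big_ord_recl big_ord0 /= addr0 addrA.
  by do 4!eexists.
have fX : free X.
  rewrite -[X]/(tval [tuple x; y; d x; d y]); apply/freeP => k.
  rewrite !big_ord_recl big_ord0 /= addr0 addrA => /L0[k1 k2 k3 k4] i.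
  case: i => [[|[|[|[|//]]]] /= hi];
    [rewrite -[RHS]k1|rewrite -[RHS]k2|rewrite -[RHS]k3|rewrite -[RHS]k4];
    by apply: (congr1 k); apply: ord_inj.
have QX : Q = <<X>>%VS.
  apply/esym/eqP; rewrite eqEdim (eqP fX) /= dQ andbT; apply/span_subvP => z.
  have edx z' : e z' = z' -> e (d z') = d z' by move=> ez'; rewrite ed ez'.
  rewrite !inE => /or4P[] /eqP->;
    by [rewrite -ex|rewrite -ey|rewrite -edx|rewrite -edx].
split; first by rewrite QX; exact/eqP.
(* [w z] is fixed by [a], so averaging it with its image under [a] removes the coordinates along
   [d x] and [d y]. *)
have wx z : e z = z -> a z = z -> exists k1 k2, w z = k1 *: x + k2 *: y.
  move=> ez az; have : w z \in Q by rewrite -ez -ew.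
  rewrite QX => /XE[k1 [k2 [k3 [k4 E]]]]; exists k1, k2.
  apply: (scalerI two_neq0); have : a (w z) = w z by rewrite aw az.
  rewrite !scaler_nat !mulr2n => {1}<-; rewrite E aL /L; vector_ring.
have w_sa z t : s (w z) t = s z (w t).
  by rewrite !wE linearD linearDl /= !(a_sa, b_sa) addrC.
have wxx z : s (w z) z = 0 by apply: selfadjoint_alt w_sa.
have [k1 [k2 Ex]] := wx x ex ax; have [k3 [k4 Ey]] := wx y ey ay.
have k20 : k2 = 0.
  have := wxx x; rewrite Ex linearDl !linearZl_LR /= s_alt syx mulr0 add0r.
  by move/eqP; rewrite mulrN oppr_eq0 mulf_eq0 (negPf sxy) orbF => /eqP.
have k30 : k3 = 0.
  have := wxx y; rewrite Ey linearDl !linearZl_LR /= s_alt mulr0 addr0.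
  by move/eqP; rewrite mulf_eq0 (negPf sxy) orbF => /eqP.
have k41 : k4 = k1.
  have := w_sa x y; rewrite Ex Ey k20 k30 !scale0r add0r addr0.
  by rewrite linearZl_LR linearZ /= => /(mulIf sxy).
move: Ex Ey; rewrite k20 k30 k41 !scale0r add0r addr0 => Ex Ey.
exists k1 => z; rewrite QX => /XE[c1 [c2 [c3 [c4 ->]]]]; rewrite -wE /L.
by rewrite !linearD !linearZ /= -!dw Ex Ey; vector_ring.
Qed.
End Dihedral.

(** * Three selfadjoint involutions whose product is the identity modulo a plane *)

Section Perturbation.
Variables (a b c : 'End(V)) (P : {vspace V}) (t : F).
Hypotheses (aa : forall x, a (a x) = x) (bb : forall x, b (b x) = x).
Hypothesis cc : forall x, c (c x) = x.
Hypotheses (a_sa : selfadjoint a) (b_sa : selfadjoint b) (c_sa : selfadjoint c).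
Hypothesis dimP : \dim P = 2%N.
Hypotheses (t2 : 2%:R - t != 0) (tN2 : 2%:R + t != 0).

Variables u v w : 'End(V).
Hypothesis uE : forall x, u x = a (b (c x)).
Hypothesis vE : forall x, v x = c (b (a x)).
Hypothesis wE : forall x, w x = a (b x) + b (a x).
Hypothesis uP : forall x, u x - x \in P.
Hypothesis uuP : forall x, x \in P -> u (u x) = t *: u x - x.

Let uv x : u (v x) = x. Proof. by rewrite uE vE cc bb aa. Qed.
Let vu x : v (u x) = x. Proof. by rewrite uE vE aa bb cc. Qed.
Let u_adj x y : s (u x) y = s x (v y).
Proof. by rewrite uE vE a_sa b_sa c_sa. Qed.

Let uPP x : x \in P -> u x \in P.
Proof. by move=> Px; rewrite -[u x](subrK x) memvD. Qed.

Let vP x : x \in P -> v x = t *: x - u x.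
Proof.
move=> Px; apply: (can_inj vu); rewrite uv linearB linearZ /= uuP //.
by rewrite opprB addrC subrK.
Qed.

(* [(2 - t) z] is the sum of a vector fixed by [u], which is orthogonal to [P],
   and of a vector of [P]. *)
Lemma plane_ndg x : x \in P -> (forall y, y \in P -> s x y = 0) -> x = 0.
Proof.
move=> Px sx; apply: s_ndg => z.
pose f := u (u z) - t *: u z + z.
have uf : u f = f.
  have := uuP _ (uP z); rewrite !lfun_lin => E.
  apply/eqP; rewrite -subr_eq0; apply/eqP.
  transitivity (u (u (u z)) - u (u z) - (t *: (u (u z) - u z) - (u z - z))).
    by rewrite /f; vector_ring.
  by rewrite E subrr.
have sf : s x f = s (u x) f by rewrite u_adj -{2}uf vu.
have sf2 : s x f = s (u (u x)) f by rewrite u_adj -{2}uf vu.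
have f0 : (2%:R - t) * s x f = 0.
  move: sf2; rewrite uuP // linearBl linearZl_LR /= -sf => E.
  by rewrite -[RHS](subrr (s x f)) {3}E; ring.
(* This uses [X^2 - t X + 1 = (X + 1 - t) (X - 1) + (2 - t)], evaluated at [u] and applied to
   [z]. *)
have : s x (u (u z - z) + (1 - t) *: (u z - z)) = 0.
  by rewrite sx // memvD ?memvZ ?uPP.
move=> E; do 2!apply: (mulfI t2); rewrite !mulr0.
rewrite -[RHS]f0 -[LHS]addr0 -(mulr0 (2%:R - t)) -E /f !form_lin; ring.
Qed.

(** The vector [u z - z] of [P] is orthogonal to [P], because the adjoint [v] of [u] preserves
    [P]. *)
Lemma plane_ortho_fixed z : (forall y, y \in P -> s z y = 0) -> u z = z.
Proof.
move=> sz; apply/eqP; rewrite -subr_eq0; apply/eqP/plane_ndg => // y Py.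
by rewrite linearBl /= u_adj !sz ?subr0 // vP // memvB ?memvZ ?uPP.
Qed.

(* Since [c] is selfadjoint, [s (c x) y] is alternating in [x] and [y], and two
   alternating forms on a plane are proportional. *)
Lemma plane_compression : exists m, forall x y, x \in P -> y \in P ->
  s (c x) y = m * s x y.
Proof.
have [e1 [e2 PE]] : exists e1 e2, forall x, x \in P ->
    exists k1 k2, x = k1 *: e1 + k2 *: e2.
  have := vbasisP P; move: (vbasis P); rewrite dimP => X bX.
  exists X`_0, X`_1 => x Px; have -> := coord_basis bX Px.
  by rewrite !big_ord_recl big_ord0 /= addr0; do 2!eexists.
have E11 : s (c e1) e1 = 0 by exact: selfadjoint_alt.
have E22 : s (c e2) e2 = 0 by exact: selfadjoint_alt.
have E21 : s (c e2) e1 = - s (c e1) e2 by rewrite form_anti c_sa.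
have S21 : s e2 e1 = - s e1 e2 by exact: form_anti.
have [s12|s12] := eqVneq (s e1 e2) 0.
  exists 0 => x y Px Py; suff -> : x = 0 by rewrite linear0 linear0l mul0r.
  apply: plane_ndg => // z Pz.
  have [k1 [k2 ->]] := PE _ Px; have [l1 [l2 ->]] := PE _ Pz.
  by rewrite !form_lin !s_alt S21 s12; ring.
exists (s (c e1) e2 / s e1 e2) => x y Px Py.
have [k1 [k2 ->]] := PE _ Px; have [l1 [l2 ->]] := PE _ Py.
by rewrite !lfun_lin !form_lin !s_alt S21 E11 E22 E21; field.
Qed.

(** * The operator [w] on [P + c P] *)

Section Trace.
Variable m : F.
Hypothesis sc : forall x y, x \in P -> y \in P -> s (c x) y = m * s x y.

Let wuE x : w x = u (c x) + c (v x).
Proof. by rewrite wE uE vE !cc. Qed.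
Let w_sa : selfadjoint w.
Proof. by move=> x y; rewrite !wE linearD linearDl /= !(a_sa, b_sa) addrC. Qed.
Let Q := (P + c @: P)%VS.

(** By [sc], the vector [c x - m x] is orthogonal to [P], hence fixed by [u]. *)
Let ucP x : x \in P -> u (c x) = c x + m *: (u x - x).
Proof.
move=> Px; have : u (c x - m *: x) = c x - m *: x.
  apply: plane_ortho_fixed => y Py.
  by rewrite linearBl linearZl_LR /= sc // subrr.
rewrite linearB linearZ /= => /eqP; rewrite subr_eq => /eqP ->.
by vector_ring.
Qed.

Let vcP x : x \in P -> v (c x) = c x + m *: (v x - x).
Proof.
move=> Px; have := congr1 v (ucP _ Px).
by rewrite !lfun_lin !vu => E; rewrite [in RHS]E; vector_ring.
Qed.

Let wP x : x \in P -> w x = m *: (u x - x) + (c x + c (t *: x - u x)).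
Proof. by move=> Px; rewrite wuE ucP // vP //; vector_ring. Qed.

Let wcP x : x \in P -> w (c x) = u x + x + m *: c (t *: x - u x - x).
Proof.
by move=> Px; rewrite wuE cc vcP // vP // linearD linearZ /= cc addrA.
Qed.

Let QE x : x \in Q -> exists y z, [/\ y \in P, z \in P & x = y + c z].
Proof. by case/memv_addP=> y Py [_ /memv_imgP[z Pz ->] ->]; exists y, z. Qed.

Let Q_mem y z : y \in P -> z \in P -> y + c z \in Q.
Proof. by move=> Py Pz; rewrite memv_add // memv_img. Qed.

Let QP y : y \in P -> y \in Q.
Proof. by move=> Py; rewrite -[y]addr0 -(linear0 c) Q_mem ?mem0v. Qed.

Let wQ x : x \in Q -> w x \in Q.
Proof.
case/QE=> y [z [Py Pz ->]]; rewrite linearD /= wP // wcP //.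
have Puy := uPP _ Py; have Puz := uPP _ Pz.
rewrite [X in X \in _](_ : _ = m *: (u y - y) + (u z + z) +
   c (y + (t *: y - u y) + m *: (t *: z - u z - z))).
  by rewrite Q_mem // !(memvD, memvZ, memvN).
by rewrite !lfun_lin; vector_ring.
Qed.

(* On [Q] the operator [w] is a 2 x 2 matrix over the commutative algebra
   generated by the restriction of [u] to [P]; this is its Cayley-Hamilton
   identity. *)
Let w_quadratic x : x \in Q ->
  w (w x) = - ((2%:R - t) * m) *: w x - ((2%:R - t) * m ^+ 2 - (2%:R + t)) *: x.
Proof.
case/QE=> y [z [Py Pz ->]].
have Puy := uPP _ Py; have Puz := uPP _ Pz.
rewrite !(lfun_lin, wP y Py, wP z Pz, wcP y Py, wcP z Pz).
rewrite !(lfun_lin, wP _ Puy, wP _ Puz, wcP _ Puy, wcP _ Puz).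
rewrite !(lfun_lin, wP y Py, wP z Pz, wcP y Py, wcP z Pz, uuP y Py, uuP z Pz).
by vector_ring.
Qed.

(** Since [w = u c + c v] and both [u - 1] and [v - 1] map into [P], [w - 2 c] maps into [Q];
    moreover [w^2 - 4 = w (w - 2 c) + 2 (w - 2 c) c]. *)
Let wwQ x : w (w x) - 4%:R *: x \in Q.
Proof.
have w2 z : w z - 2%:R *: c z \in Q.
  have Pv : v z - z \in P by rewrite -{2}[z]uv -opprB memvN.
  rewrite [X in X \in _](_ : _ = u (c z) - c z + c (v z - z)) ?Q_mem //.
  by rewrite wuE linearB /=; vector_ring.
have -> : w (w x) - 4%:R *: x =
    w (w x - 2%:R *: c x) + 2%:R *: (w (c x) - 2%:R *: c (c x)).
  by rewrite cc linearB linearZ /=; vector_ring.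
by rewrite memvD ?memvZ ?wQ.
Qed.

Let e_ k1 k0 := ((w \o w - 4%:R *: \1) \o (k1 *: w + k0 *: \1))%VF.
Let e_E k1 k0 x : e_ k1 k0 x =
  k1 *: (w (w (w x)) - 4%:R *: w x) + k0 *: (w (w x) - 4%:R *: x).
Proof.
rewrite /e_ !(comp_lfunE, add_lfunE, opp_lfunE, scale_lfunE, id_lfunE).
by rewrite !lfun_lin; vector_ring.
Qed.

Let P_neq0 : exists2 x, x \in P & x != 0.
Proof.
by exists (vpick P); rewrite ?memv_pick // vpick0 -dimv_eq0 dimP.
Qed.

(** A nonzero one would satisfy the hypotheses of [dihedral_scalar]: where [a] and [b] commute,
    [w = 2 a b], so the factor [w^2 - 4] of [e_ k1 k0] vanishes. *)
Lemma idempotent_trivial k1 k0 :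
  (forall x, e_ k1 k0 (e_ k1 k0 x) = e_ k1 k0 x) -> forall x, e_ k1 k0 x = 0.
Proof.
set e := e_ k1 k0 => ee x0; apply/eqP/negPn/negP => ex0.
have wa x : w (a x) = a (w x) by rewrite !wE linearD /= !aa addrC.
have wb x : w (b x) = b (w x) by rewrite !wE linearD /= !bb addrC.
have dQ : (\dim Q <= 4)%N.
  rewrite (leq_trans (dimv_add_leqif P (c @: P)%VS)) // dimP (leq_add2l 2 _ 2).
  by rewrite -dimP -(limg_ker_dim c P) leq_addl.
have [|||||dQ4 [l wl]] :=
  @dihedral_scalar a b e Q aa bb a_sa b_sa _ ee _ _ _ _ dQ (ex_intro _ x0 ex0).
- by move=> x y; rewrite !e_E !form_lin !w_sa.
- by move=> x; rewrite e_E memvD ?memvZ ?wwQ.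
- by move=> x; rewrite !e_E !wa !lfun_lin.
- by move=> x; rewrite !e_E !wb !lfun_lin.
- move=> x exx abx; rewrite -exx e_E.
  have wx : w x = 2%:R *: a (b x) by rewrite wE -abx scaler_nat mulr2n.
  have wwx : w (w x) = 4%:R *: x.
    rewrite wx lfunZ wE {1}abx !(aa, bb) -mulr2n -scaler_nat scalerA.
    by congr (_ *: _); ring.
  by rewrite wwx lfunZ !subrr !scaler0 addr0.
have [x Px x_neq0] := P_neq0.
have capPc : (P :&: c @: P)%VS = 0%VS.
  have dcP : (\dim (c @: P) <= 2)%N.
    by rewrite -dimP -(limg_ker_dim c P) leq_addl.
  apply/eqP; rewrite -dimv_eq0; have := dimv_sum_cap P (c @: P)%VS.
  rewrite -/Q dQ4 dimP => E; move: dcP.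
  by rewrite -(leq_add2l 2) -E -[X in (_ <= X)%N]addn0 leq_add2l leqn0.
(* By [wP], [l x = m (u x - x) + c ((1 + t) x - u x)], so the last term lies in both [P] and
   [c P]. *)
have ux : u x = (1 + t) *: x.
  apply/eqP; rewrite eq_sym -subr_eq0 -memv0.
  have : c ((1 + t) *: x - u x) \in (P :&: c @: P)%VS.
    rewrite memv_cap memv_img ?memvD ?memvN ?memvZ ?uPP // andbT.
    have -> : c ((1 + t) *: x - u x) = l *: x - m *: (u x - x).
      have := wl x (QP _ Px); rewrite -wE wP // => <-.
      by rewrite !lfun_lin; vector_ring.
    by rewrite !(memvD, memvN, memvZ) // uPP.
  by rewrite capPc !memv0 => /eqP /(congr1 c); rewrite cc linear0 => ->.
have := uuP x Px; rewrite ux linearZ /= ux => /eqP; rewrite -subr_eq0.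
rewrite (_ : _ - _ = (2%:R + t) *: x); last by vector_ring.
by rewrite scaler_eq0 (negPf tN2) (negPf x_neq0).
Qed.

(* If [m ^ 2 != 1], then [w ^ 2 - 4] is invertible on [Q] and the idempotent has
   image [Q]; if [m ^ 2 = 1], then the quadratic polynomial of [w] on [Q] is
   [(X + 2 * m) * (X - m * t)] and the idempotent projects onto the eigenspace
   of [w] for [m * t]. *)
Lemma plane_perturbation_absurd : False.
Proof.
have [x Px x_neq0] := P_neq0.
have [m1|m1] := eqVneq (m ^+ 2) 1; last first.
  (* Modulo the quadratic of [w_quadratic], [X^2 - 4] is [- (2 - t) (m X + m^2 + 1)], and
     [k1 X + k0] is its inverse. *)
  pose K := ((2%:R - t) * (1 - m ^+ 2) ^+ 2)^-1.
  pose k1 := K * m; pose k0 := K * ((2%:R - t) * m ^+ 2 - 1 - m ^+ 2).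
  have K1 : K * ((2%:R - t) * (1 - m ^+ 2) ^+ 2) = 1.
    by rewrite mulVf // mulf_neq0 // expf_neq0 // subr_eq0 eq_sym.
  have eQ q : q \in Q -> e_ k1 k0 q = q.
    move=> Qq; rewrite -[RHS]scale1r -K1 e_E (w_quadratic _ (wQ _ Qq)).
    rewrite (w_quadratic _ Qq) /k1 /k0; vector_ring.
  have /negP[] := x_neq0; apply/eqP; rewrite -(eQ x) ?QP //.
  apply: idempotent_trivial => y; apply: eQ.
  by rewrite e_E memvD ?memvZ ?wwQ.
(* The factor [X + 2 m] kills the other eigenvalue, and [k] makes [k (X^2 - 4) (X + 2 m)] equal to 1
   at [m t]. *)
pose k := m / ((t + 2%:R) * (t ^+ 2 - 4%:R)).
have e_eig z : w z = (m * t) *: z -> e_ k (2%:R * k * m) z = z.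
  move=> wz; rewrite e_E !(lfunZ, wz) -[RHS]scale1r.
  suff E : k * m * (t + 2%:R) * (m ^+ 2 * t ^+ 2 - 4%:R) = 1.
    by rewrite -[X in _ = X *: _]E; vector_ring.
  rewrite m1 mul1r /k; transitivity (m ^+ 2 *
    (((t + 2%:R) * (t ^+ 2 - 4%:R))^-1 * ((t + 2%:R) * (t ^+ 2 - 4%:R)))).
    by ring.
  rewrite mulVf ?mulr1 // (_ : _ * _ = - ((2%:R - t) * (2%:R + t) ^+ 2)).
    by rewrite oppr_eq0 mulf_neq0 ?expf_neq0.
  by ring.
have w_eig q : q \in Q ->
    w (w q + (2%:R * m) *: q) = (m * t) *: (w q + (2%:R * m) *: q).
  move=> Qq; rewrite lfunD lfunZ (w_quadratic _ Qq).
  apply: form_inj => y; rewrite !form_lin m1 mulr1.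
  transitivity (m * t * s (w q) y + m ^+ 2 * 2%:R * t * s q y); last by ring.
  by rewrite m1; ring.
have e0 := idempotent_trivial k (2%:R * k * m).
have Z0 : w x + (2%:R * m) *: x = 0.
  rewrite -[LHS](e_eig _ (w_eig _ (QP _ Px))); apply: e0 => y.
  apply: e_eig; rewrite e_E; set q := w (w y) - _.
  have -> : w (w (w y)) - 4%:R *: w y = w q by rewrite /q !lfun_lin.
  have -> : k *: w q + (2%:R * k * m) *: q = k *: (w q + (2%:R * m) *: q).
    by vector_ring.
  by rewrite lfunZ w_eig ?wwQ // !scalerA mulrC.
(* Pairing [w x = - 2 m x] with [y], where [c] acts as [m], cancels the terms in [u x] and leaves
   [(2 + t) m s(x, y) = 0]. *)
have /negP[] := x_neq0; apply/eqP/plane_ndg => // y Py.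
have Pux := uPP _ Px.
have m0 : m != 0.
  by apply: contra_eq_neq m1 => ->; rewrite expr0n eq_sym oner_eq0.
apply: (mulfI m0); apply: (mulfI tN2); rewrite !mulr0.
have := congr1 (fun z => s z y) Z0.
rewrite wP // !lfun_lin !form_lin !sc // => <-; ring.
Qed.

End Trace.

Lemma triple_involution_product_absurd : False.
Proof.
by have [m sc] := plane_compression; exact: (plane_perturbation_absurd _ sc).
Qed.

End Perturbation.
End AlternatingForm.

(** * Quadratic palindromials and evaluation at an operator *)

Lemma quadratic_palindromial_coefs (F : fieldType) (p : {poly F}) :
    2%:R != 0 :> F -> p \is monic -> palindromial p -> size p = 3%N ->
  ~~ root p 1 -> p`_0 = 1 /\ p`_2 = 1.
Proof.
move=> two_neq0 /monicP; rewrite lead_coefE => p2 [_ p0 pE] sp pr.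
rewrite sp /= in p2.
move: p0 pE; rewrite /reciprocal_poly sp horner_coef0 => p0 pE.
have rev k : (k <= 2)%N -> p`_k = (p`_0)^-1 * p`_(2 - k).
  move=> k2; rewrite {1}pE coefZ coef_sum; congr (_ * _).
  rewrite !big_ord_recl big_ord0 !coefZ !coefXn.
  by case: k k2 => [|[|[|//]]] _ /=; rewrite !(mulr0, mulr1, addr0, add0r).
split=> //; have := rev 0%N isT; rewrite subn0 p2 mulr1 => c0.
(* The constant term is 1 or -1; the latter would give [p = X^2 - 1], which has the root 1. *)
have : p`_0 ^+ 2 = 1 by rewrite expr2 {1}c0 mulVf.
move/eqP; rewrite sqrf_eq1 => /orP[/eqP //|/eqP c1].
have p1 : p`_1 = 0.
  have := rev 1%N isT; rewrite c1 invrN invr1 mulN1r => /eqP.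
  by rewrite -addr_eq0 -mulr2n -mulr_natl mulf_eq0 (negPf two_neq0) => /eqP.
case/negP: pr; rewrite /root horner_coef sp !big_ord_recl big_ord0 /= c1 p2 p1.
by rewrite mul0r addr0 add0r !expr1n !mulr1 addNr.
Qed.

Lemma lfun_hornerE (F : fieldType) (V : vectType F) (p : {poly F}) n
    (u : 'End(V)) x : (size p <= n)%N ->
  lfun_horner p u x = \sum_(k < n) p`_k *: iter k u x.
Proof.
move=> pn; rewrite /lfun_horner sum_lfunE.
rewrite (big_ord_widen n (fun k => (p`_k *: iter k (comp_lfun u) \1%VF) x)) //.
rewrite [RHS](bigID (fun k : 'I_n => (k < size p)%N)) /= [X in _ + X]big1.
  rewrite addr0; apply: eq_bigr => k _; rewrite scale_lfunE; congr (_ *: _).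
  by elim: (k : nat) => [|m IH] /=; rewrite ?id_lfunE // comp_lfunE IH.
by move=> k; rewrite -leqNgt => /(nth_default 0) ->; rewrite scale0r.
Qed.

Theorem proposition7p1 (F : fieldType) (hF : 2%N \notin [pchar F])
    (p : {poly F}) (p_monic : p \is monic) (p_pal : palindromial p)
    (p_deg2 : size p = 3%N) (p_root1 : ~~ root p 1) (p_rootN1 : ~~ root p (-1))
    (V : vectType F) (s : {biscalar V}) (s_sympl : symplectic_form s)
    (u : 'End(V)) (u_Sp : Sp s u) (u_min : is_minpoly u (('X - 1) * p))
    (u_ker : \dim (lker (lfun_horner p u)) = 2%N) :
  ~ Sp_reflectional s 3 u.
Proof.
move=> [i [invol u_prod]]; have [s_alt s_ndg] := s_sympl.
have two_neq0 : 2%:R != 0 :> F by move: hF; rewrite inE.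
have ii k x : i k (i k x) = x.
  by have [_ /lfunP/(_ x)] := invol k; rewrite comp_lfunE id_lfunE.
(* An isometry equal to its own inverse is its own adjoint. *)
have i_sa k : selfadjoint F V s (i k).
  by move=> x y; have [[_ isom] _] := invol k; rewrite -{1}[y](ii k) isom.
have [p0 p2] :=
  quadratic_palindromial_coefs _ _ two_neq0 p_monic p_pal p_deg2 p_root1.
pose t := - p`_1.
have pu x : lfun_horner p u x = u (u x) - t *: u x + x.
  rewrite (@lfun_hornerE _ _ _ 3) ?p_deg2 // !big_ord_recl big_ord0 /= p0 p2.
  by rewrite !scale1r addr0 /t scaleNr opprK addrC [X in X + x]addrC.
have ann x : lfun_horner p u (u x - x) = 0.
  have : lfun_horner (('X - 1) * p) u x = 0.
    by have [_ /(_ (('X - 1) * p))[_ ->]] := u_min; rewrite ?dvdpp ?zero_lfunE.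
  have p3 : p`_3 = 0 by rewrite nth_default ?p_deg2.
  rewrite (@lfun_hornerE _ _ _ 4); last first.
    rewrite (leq_trans (size_polyMleq _ _)) // p_deg2.
    by rewrite -[1]/(1%:P) size_XsubC.
  rewrite !big_ord_recl big_ord0 /= !mulrBl !mul1r !coefB !coefXM /= p0 p2 p3.
  rewrite pu !linearB /= /t => <-; apply: (form_inj F V s s_ndg) => y.
  by rewrite !(linearDl, linearNl, linearZl_LR, linear0l) /=; ring.
have horner3 x : p.[x] = 1 - t * x + x ^+ 2.
  rewrite horner_coef p_deg2 !big_ord_recl big_ord0 /= p0 p2 /t.
  by rewrite addr0 expr0 expr1 !mul1r mulNr opprK addrA.
have t2 : 2%:R - t != 0.
  move: p_root1; rewrite /root horner3; apply: contraNneq => E.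
  by rewrite -E; apply/eqP; ring.
have tN2 : 2%:R + t != 0.
  move: p_rootN1; rewrite /root horner3; apply: contraNneq => E.
  by rewrite -E; apply/eqP; ring.
have u_abc x : u x = i 0 (i 1 (i 2%:R x)).
  rewrite u_prod !big_ord_recl big_ord0 !comp_lfunE id_lfunE.
  by congr (i _ (i _ (i _ x))); apply: ord_inj.
apply: (triple_involution_product_absurd F V s s_alt s_ndg two_neq0 (i 0) (i 1)
  (i 2%:R) (lker (lfun_horner p u)) t _ _ _ _ _ _ u_ker t2 tN2 u
  (i 2%:R \o i 1 \o i 0)%VF ((i 0 \o i 1) + (i 1 \o i 0))%VF) => // x.
- by rewrite !comp_lfunE.
- by rewrite add_lfunE !comp_lfunE.
- by rewrite memv_ker ann.
- rewrite memv_ker pu => /eqP E; apply/eqP.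
  by rewrite -subr_eq0 opprB addrCA addrC E.
Qed.
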